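(* Let $g,K$ be positive integers with $K<2g$, let $x_1,\dots,x_K$ be independent complex variables, let $u_1,\dots,u_{2g-1-K}$ be differentiable functions of $(x_1,\dots,x_K)$, and let $\mathcal B=\{0,1,x_1,\dots,x_K,u_1,\dots,u_{2g-1-K}\}$ consist of $2g+1$ distinct points. Let $A_{a_j}$, $a_j\in\mathcal B$, be $2\times2$ matrices depending on $(x_1,\dots,x_K)$ and independent of $u$. The constrained Schlesinger system, i.e. the compatibility condition of the linear systems $$\frac{d\Phi}{du}=\Big(\frac{A_0}{u}+\frac{A_1}{u-1}+\sum_{i=1}^K\frac{A_{x_i}}{u-x_i}+\sum_{j=1}^{2g-1-K}\frac{A_{u_j}}{u-u_j}\Big)\Phi,\qquad \Phi_{x_i}\Phi^{-1}=-\frac{A_{x_i}}{u-x_i}-\sum_{j=1}^{2g-1-K}\frac{A_{u_j}}{u-u_j}\frac{\partial u_j}{\partial x_i}\quad(1\le i\le K),$$ has the form: for every $1\le i\le K$, $$\partial_{x_i}A_{a_j}=\frac{[A_{x_i},A_{a_j}]}{x_i-a_j}+\sum_{k=1}^{2g-1-K}\frac{[A_{u_k},A_{a_j}]}{u_k-a_j}\frac{\partial u_k}{\partial x_i}\quad\text{for }a_j\notin\{x_i,u_1,\dots,u_{2g-1-K}\};$$ $$\partial_{x_i}A_{u_m}=\frac{[A_{x_i},A_{u_m}]}{x_i-u_m}+\sum_{\substack{k=1 \\ k\ne m}}^{2g-1-K}\frac{[A_{u_k},A_{u_m}]}{u_k-u_m}\frac{\partial u_k}{\partial x_i}-\frac{\partial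 u_m}{\partial x_i}\sum_{\substack{a_j\in\mathcal B \\ a_j\neq u_m}}\frac{[A_{a_j},A_{u_m}]}{a_j-u_m}\quad\text{for }1\le m\le 2g-1-K;$$ $$\partial_{x_i}A_{x_i}=-\sum_{\substack{a_j\in\mathcal B \\ a_j\ne x_i}}\frac{[A_{x_i},A_{a_j}]}{x_i-a_j}+\sum_{k=1}^{2g-1-K}\frac{[A_{u_k},A_{x_i}]}{u_k-x_i}\frac{\partial u_k}{\partial x_i}.$$
   Context: Write the two linear systems as $\Phi_u=A\Phi$ and $\Phi_{x_i}=U_i\Phi$, with $A=\sum_{a\in\mathcal B}\frac{A_a}{u-a}$ and $U_i=-\frac{A_{x_i}}{u-x_i}-\sum_j\frac{A_{u_j}}{u-u_j}\frac{\partial u_j}{\partial x_i}$. Their compatibility condition is $\partial_{x_i}A-\partial_uU_i+[A,U_i]=0$ identically in $u\in\mathbb C\setminus\mathcal B$, for each $i=1,\dots,K$. The matrix $A_{a}$ denotes the residue at $u=a$; in $\partial_{x_i}A$ the points $x_i$ and $u_j(x_1,\dots,x_K)$ are differentiated. *)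

(* Defs.v *)
From HB Require Import structures.
From mathcomp Require Import all_boot all_order all_algebra.
From mathcomp Require Import complex.
From mathcomp Require Import boolp classical_sets functions reals.
From mathcomp Require Import topology normedtype derive.
Set Implicit Arguments.
Unset Strict Implicit.
Unset Printing Implicit Defensive.
Import Order.TTheory GRing.Theory Num.Theory.
Import numFieldNormedType.Exports.
Local Open Scope classical_set_scope.
Local Open Scope ring_scope.

(* The field R[i] with the topology of its modulus: normed modules and 'D_v
   over it are those of any numFieldType, so derivatives are complex ones. *)
Definition Cfield (R : realType) : numFieldType := R[i].

(* Labels of the K + N + 2 poles: inl false, inl true, inr (inl i) and
   inr (inr j) stand for 0, 1, x_i and u_j. *)
Definition pole (K N : nat) : finType := (bool + ('I_K + 'I_N))%type.
Definition poleX {K N : nat} (i : 'I_K) : pole K N := inr (inl i).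
Definition poleU {K N : nat} (j : 'I_N) : pole K N := inr (inr j).

Section Schlesinger.
Context {C : numFieldType} {K N : nat}.
Implicit Types (x : 'rV[C]_K) (z : C) (i : 'I_K) (D : set 'rV[C]_K).

Definition partial {V : normedModType C} i (f : 'rV[C]_K -> V) x : V :=
  'D_(delta_mx ord0 i : 'rV[C]_K) f x.

Definition bracket (M P : 'M[C]_2) : 'M[C]_2 := M *m P - P *m M.

Variables (u : 'I_N -> 'rV[C]_K -> C) (A : pole K N -> 'rV[C]_K -> 'M[C]_2).

Definition pole_at (a : pole K N) x : C :=
  match a with
  | inl b => if b then 1 else 0
  | inr (inl i) => x ord0 i
  | inr (inr j) => u j x
  end.

Definition Amat x z : 'M[C]_2 := \sum_(a : pole K N) (z - pole_at a x)^-1 *: A a x.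

Definition Umat i x z : 'M[C]_2 :=
  - ((z - x ord0 i)^-1 *: A (poleX i) x)
  - \sum_(j < N) (partial i (u j) x / (z - u j x)) *: A (poleU j) x.

(* Compatibility of Phi_z = Amat Phi and Phi_(x_i) = Umat i Phi; the partial
   derivative is taken at fixed z, so it also acts on the x_i and u_j in Amat. *)
Definition compatible D : Prop :=
  forall i x, D x -> forall z, (forall a, z != pole_at a x) ->
    partial i (fun y => Amat y z) x - 'D_1 (Umat i x) z
      + bracket (Amat x z) (Umat i x z) = 0.

Definition schlesinger_fixed i x : Prop :=
  forall a : pole K N, a != poleX i -> (forall k, a != poleU k) ->
    partial i (A a) x =
      (x ord0 i - pole_at a x)^-1 *: bracket (A (poleX i) x) (A a x)
      + \sum_(k < N) (partial i (u k) x / (u k x - pole_at a x))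
          *: bracket (A (poleU k) x) (A a x).

Definition schlesinger_u i x : Prop :=
  forall m : 'I_N,
    partial i (A (poleU m)) x =
      (x ord0 i - u m x)^-1 *: bracket (A (poleX i) x) (A (poleU m) x)
      + \sum_(k < N | k != m) (partial i (u k) x / (u k x - u m x))
          *: bracket (A (poleU k) x) (A (poleU m) x)
      - partial i (u m) x *:
          \sum_(a : pole K N | a != poleU m) (pole_at a x - u m x)^-1
            *: bracket (A a x) (A (poleU m) x).

Definition schlesinger_x i x : Prop :=
  partial i (A (poleX i)) x =
    - (\sum_(a : pole K N | a != poleX i) (x ord0 i - pole_at a x)^-1
        *: bracket (A (poleX i) x) (A a x))
    + \sum_(k < N) (partial i (u k) x / (u k x - x ord0 i))
        *: bracket (A (poleU k) x) (A (poleX i) x).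

Definition constrained_schlesinger D : Prop :=
  forall i x, D x ->
    [/\ schlesinger_fixed i x, schlesinger_u i x & schlesinger_x i x].

End Schlesinger.

(* Main.v *)
Require Import Defs.
From HB Require Import structures.
From mathcomp Require Import all_boot all_order all_algebra.
From mathcomp Require Import complex.
From mathcomp Require Import boolp classical_sets functions reals.
From mathcomp Require Import topology normedtype derive.
From mathcomp Require Import ring.
Import Order.TTheory GRing.Theory Num.Theory.
Import numFieldNormedType.Exports.
Local Open Scope classical_set_scope.
Local Open Scope ring_scope.

(** Fix [i] and [x], and write [p a] for the poles, [q a] for their velocities
    in the direction [x_i] (zero at 0, at 1 and at the other [x_j]). With this
    notation [Umat] is [- \sum_a q a / (z - p a) *: A a]: all poles play the same
    role, and only their velocities differ.

    As functions of [z], the two derivatives in the compatibility condition have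
    the double poles [q a / (z - p a) ^+ 2 *: A a], which cancel, and the
    commutator has none, because [A a] commutes with itself. Splitting
    [1 / ((z - p a) (z - p b))] into simple fractions turns the left-hand side of
    the condition into a sum of simple fractions whose residue at [p c] is
    [partial i (A c) - schlesinger_rhs c] ([compatibility_expansion]), where
    [schlesinger_rhs c] is the sum over [b] different from [c] of
    [(q b - q c) / (p b - p c) *: bracket (A b) (A c)].

    Simple fractions at distinct poles are linearly independent
    ([residues_eq0]), hence the condition holds for all [z] if and only if every
    residue vanishes. Inserting the velocities, which are [0], [1] or a partial
    derivative of some [u_j], gives the three families of equations
    ([schlesinger_equations]). *)

(** * Differentiation along a direction *)

Section DirectionalDerivatives.
Context {C : numFieldType} {V W : normedModType C}.

(** The difference quotient of [k *: f] splits into those of [f] and [k],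
    the first one weighted by a shifted value of [k]: hence the appeal to the
    continuity of [k] along the direction [v]. *)
Lemma is_derive_scale (k : V -> C) (f : V -> W) (x v : V) (dk : C) (df : W) :
  is_derive x v k dk -> is_derive x v f df ->
  is_derive x v (fun y => k y *: f y) (k x *: df + dk *: f x).
Proof.
move=> [kx <-] [fx <-].
set l := (X in is_derive _ _ _ X).
suff cl : (fun h : C => h^-1 *: (((fun y => k y *: f y) \o shift x) (h *: v)
                             - k x *: f x)) @ 0^' --> l.
  by split; [apply/cvg_ex; exists l | exact: cvg_lim cl].
rewrite [X in X @ _](_ : _ =
  fun h => k (h *: v + x) *: (h^-1 *: ((f \o shift x) (h *: v) - f x))
         + (h^-1 *: ((k \o shift x) (h *: v) - k x)) *: f x); last first.
  apply/funext => h /=.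
  rewrite -[in RHS]scalerA [k _ *: (_ *: _)]scalerA [k _ * _]mulrC -scalerA.
  rewrite -scalerDr; congr (_ *: _).
  by rewrite scalerBr scalerBl addrA subrK.
apply: cvgD; last exact: cvgZr_tmp kx.
apply: cvg_comp2 (@scale_continuous _ _ (_, _)) => /=; last exact: fx.
suff : {for 0, continuous (fun h : C => k (h *: v + x))}.
  by move=> /continuous_withinNx; rewrite scale0r add0r.
exact/differentiable_continuous/derivable1_diffP/(derivable1P _ _ _).1.
Qed.

Lemma is_derive_sum_fin (I : finType) (h : I -> V -> W) (dh : I -> W)
    (x v : V) :
  (forall a, is_derive x v (h a) (dh a)) ->
  is_derive x v (fun y => \sum_a h a y) (\sum_a dh a).
Proof.
move=> hd; rewrite (_ : (fun y => _) = \sum_a h a); last first.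
  by apply/funext => y; rewrite fct_sumE.
by elim/big_ind2 : _ => // [|] *; [exact: is_derive_cst|exact: is_deriveD].
Qed.

Lemma is_derive_inv (k : V -> C) (x v : V) (dk : C) :
  k x != 0 -> is_derive x v k dk ->
  is_derive x v (fun y => (k y)^-1) (- dk / k x ^+ 2).
Proof.
move=> kx0 [kx <-]; split; first exact: derivableV.
by rewrite deriveV// scaleNr mulNr mulrC.
Qed.

End DirectionalDerivatives.

Lemma is_derive_coord {C : numFieldType} {n : nat} (j : 'I_n)
    (x v : 'rV[C]_n) :
  is_derive x v (fun y : 'rV[C]_n => y ord0 j : C) (v ord0 j).
Proof.
have E : \forall h \near (0 : C)^',
    h^-1 *: (((fun y : 'rV[C]_n => y ord0 j : C) \o shift x) (h *: v) - x ord0 j)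
    = v ord0 j.
  near=> h; rewrite /= !mxE addrK [_ *: _]mulKf//.
  by near: h; exact: nbhs_dnbhs_neq.
by split; [exact: is_cvg_near_cst E | exact: lim_near_cst E].
Unshelve. all: by end_near. Qed.

(** * Residues of rational functions *)

(** Clearing denominators turns the hypothesis into the vanishing of a
    polynomial off its finitely many poles, hence at infinitely many points;
    evaluating it at the pole [p c] leaves only the term of [M c]. *)
Lemma simple_fractions_free {C : numFieldType} {I : finType} (p M : I -> C) :
  injective p ->
  (forall z, (forall a, z != p a) -> \sum_a (z - p a)^-1 * M a = 0) ->
  forall c, M c = 0.
Proof.
move=> p_inj eq0 c.
pose Q := \prod_a ('X - (p a)%:P).
pose P := \sum_a M a *: \prod_(b | b != a) ('X - (p b)%:P).
have Qn0 : Q != 0 by apply/prodf_neq0 => a _; rewrite polyXsubC_eq0.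
(* The factor Q makes the product vanish at the poles as well. *)
have PQ0 z : (P * Q).[z] = 0.
  case: (boolP [forall a, z != p a]) => [/forallP zp|]; last first.
    rewrite negb_forall => /existsP[a]; rewrite negbK => /eqP ->.
    by rewrite hornerM horner_prod (bigD1 a)//= hornerXsubC subrr mul0r mulr0.
  rewrite hornerM; have -> : P.[z] = Q.[z] * \sum_a (z - p a)^-1 * M a.
    rewrite mulr_sumr horner_sum; apply: eq_bigr => a _.
    rewrite hornerZ !horner_prod [in RHS](bigD1 a)//= hornerXsubC.
    have : z - p a != 0 by rewrite subr_eq0.
    by move=> za; field.
  by rewrite eq0// mulr0 mul0r.
have /eqP : P * Q = 0.
  apply: (@roots_geq_poly_eq0 _ _ [seq n%:R | n <- iota 0 (size (P * Q))]).
  - by apply/allP => z _; rewrite rootE PQ0.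
  - by rewrite map_inj_uniq ?iota_uniq//; exact: mulrIn (oner_neq0 _).
  - by rewrite size_map size_iota.
rewrite mulf_eq0 (negbTE Qn0) orbF => /eqP/(congr1 (horner^~ (p c))).
rewrite horner0 horner_sum (bigD1 c)//= [X in _ + X]big1 => [|a ac].
  rewrite addr0 hornerZ horner_prod => /eqP; rewrite mulf_eq0 => /orP[/eqP//|].
  move=> /prodf_eq0[b bc]; rewrite hornerXsubC subr_eq0 => /eqP/p_inj cb.
  by rewrite cb eqxx in bc.
by rewrite hornerZ horner_prod (bigD1 c) 1?eq_sym//= hornerXsubC subrr mul0r mulr0.
Qed.

Lemma residues_eq0 {C : numFieldType} {I : finType} {m n : nat} (p : I -> C)
    (M : I -> 'M[C]_(m, n)) :
  injective p ->
  (forall z, (forall a, z != p a) -> \sum_a (z - p a)^-1 *: M a = 0) ->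
  forall c, M c = 0.
Proof.
move=> p_inj eq0 c; apply/matrixP => i j; rewrite mxE.
apply: (@simple_fractions_free _ _ p (fun a => M a i j)) => // z zp.
have /matrixP/(_ i j) := eq0 z zp.
rewrite summxE [RHS]mxE => eqz; rewrite -[RHS]eqz.
by apply: eq_bigr => a _; rewrite mxE.
Qed.

(** * The commutator *)

Section Bracket.
Context {C : numFieldType}.
Implicit Types M P : 'M[C]_2.

Lemma bracketxx M : bracket M M = 0.
Proof. exact: subrr. Qed.

Lemma bracketC M P : bracket M P = - bracket P M.
Proof. by rewrite /bracket opprB. Qed.

Lemma bracketZl k M P : bracket (k *: M) P = k *: bracket M P.
Proof. by rewrite /bracket -scalemxAl -scalemxAr scalerBr. Qed.

Lemma bracketNr M P : bracket M (- P) = - bracket M P.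
Proof. by rewrite /bracket mulmxN mulNmx opprB opprK addrC. Qed.

Lemma bracket_suml (I : finType) (F : I -> 'M[C]_2) P :
  bracket (\sum_a F a) P = \sum_a bracket (F a) P.
Proof. by rewrite /bracket mulmx_suml mulmx_sumr -sumrB. Qed.

Lemma bracketZr k M P : bracket M (k *: P) = k *: bracket M P.
Proof. by rewrite bracketC bracketZl -scalerN -bracketC. Qed.

Lemma bracket_sumr (I : finType) (F : I -> 'M[C]_2) P :
  bracket P (\sum_a F a) = \sum_a bracket P (F a).
Proof.
by rewrite bracketC bracket_suml -sumrN; apply: eq_bigr => a _; rewrite -bracketC.
Qed.

End Bracket.

(** The right-hand side of the Schlesinger equation for the residue at [p c]
    when the poles [p] move with velocities [q]. Both the commutator and the
    quotient vanish at [a = c], so that summing over all labels is harmless. *)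
Definition schlesinger_rhs {C : numFieldType} {I : finType} (p q : I -> C)
    (A : I -> 'M[C]_2) (c : I) : 'M[C]_2 :=
  \sum_a (q a / (p a - p c)) *: bracket (A a) (A c)
  - q c *: \sum_a (p a - p c)^-1 *: bracket (A a) (A c).

(** The product of the fractions at two distinct poles is the difference of
    these fractions divided by the difference of the poles; on the diagonal the
    commutator vanishes, so the commutator has no double pole. *)
Lemma bracket_simple_fractions {C : numFieldType} {I : finType} (p q : I -> C)
    (A : I -> 'M[C]_2) (z : C) :
  injective p -> (forall a, z != p a) ->
  bracket (\sum_a (z - p a)^-1 *: A a) (- \sum_a (q a / (z - p a)) *: A a)
  = - \sum_c (z - p c)^-1 *: schlesinger_rhs p q A c.
Proof.
move=> p_inj zp; rewrite bracketNr; congr (- _).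
under [RHS]eq_bigr => c _.
  rewrite /schlesinger_rhs !scaler_sumr -sumrB scaler_sumr.
  over.
pose t a b := (z - p b)^-1 *: ((q b / (p a - p b)) *: bracket (A a) (A b)).
pose s a b := (z - p b)^-1 *: ((q a / (p a - p b)) *: bracket (A a) (A b)).
transitivity (\sum_a \sum_b (s b a - t a b)).
  rewrite bracket_suml; apply: eq_bigr => a _.
  rewrite bracket_sumr; apply: eq_bigr => b _.
  rewrite bracketZl bracketZr /s /t [bracket (A b) _]bracketC !scalerN -opprD.
  rewrite !scalerA -scalerDl.
  have [->|ab] := eqVneq a b; first by rewrite bracketxx !scaler0 oppr0.
  rewrite -scaleNr; congr (_ *: _).
  have za : z - p a != 0 by rewrite subr_eq0.
  have zb : z - p b != 0 by rewrite subr_eq0.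
  have pab : p a - p b != 0 by rewrite subr_eq0 (inj_eq p_inj).
  have pba : p b - p a != 0 by rewrite subr_eq0 (inj_eq p_inj) eq_sym.
  by field; rewrite za zb pab pba.
rewrite (eq_bigr _ (fun a _ => sumrB _ _ _ _)).
rewrite sumrB [X in _ - X]exchange_big -sumrB; apply: eq_bigr => c _.
rewrite -sumrB; apply: eq_bigr => a _.
by rewrite /s /t [in RHS]scalerBr !scalerA !mulrA.
Qed.

(** * The constrained Schlesinger system *)

Section Compatibility.
Context {C : numFieldType} {K N : nat}.
Variables (u : 'I_N -> 'rV[C]_K -> C) (A : pole K N -> 'rV[C]_K -> 'M[C]_2).
Variables (i : 'I_K) (x : 'rV[C]_K).
Hypothesis u_der : forall j, derivable (u j) x (delta_mx ord0 i : 'rV[C]_K).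
Hypothesis A_der : forall a, derivable (A a) x (delta_mx ord0 i : 'rV[C]_K).
Hypothesis p_inj : injective (fun a => pole_at u a x).

Definition velocity (a : pole K N) : C :=
  match a with
  | inl _ => 0
  | inr (inl j) => (i == j)%:R
  | inr (inr j) => partial i (u j) x
  end.

Lemma is_derive_pole_at a :
  is_derive x (delta_mx ord0 i : 'rV[C]_K) (pole_at u a) (velocity a).
Proof.
case: a => [b|[j|j]] /=.
- exact: is_derive_cst.
- by apply: is_derive_eq (is_derive_coord _ _ _) _; rewrite mxE eqxx eq_sym.
- exact: (derivableP (u_der j)).
Qed.

Lemma sum_velocity (k : pole K N -> C) (F : pole K N -> 'M[C]_2) :
  \sum_a (velocity a * k a) *: F a =
  k (poleX i) *: F (poleX i)
  + \sum_(j < N) (partial i (u j) x * k (poleU j)) *: F (poleU j).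
Proof.
rewrite big_sumType/= big1 => [|b _]; last by rewrite mul0r scale0r.
rewrite add0r big_sumType/= (bigD1 i)//= big1 => [|j ji].
  by rewrite eqxx mul1r addr0.
by rewrite eq_sym (negbTE ji) mul0r scale0r.
Qed.

Lemma UmatE z :
  Umat u A i x z = - \sum_a (velocity a / (z - pole_at u a x)) *: A a x.
Proof.
by rewrite (sum_velocity (fun a => (z - pole_at u a x)^-1) (A^~ x)) opprD.
Qed.

(** The motion of the poles contributes the double poles
    [velocity a *: A a / (z - p a) ^+ 2], and the same ones come from
    differentiating [Umat] in [z]. *)
Lemma compatibility_expansion z : (forall a, z != pole_at u a x) ->
  partial i (fun y => Amat u A y z) x - 'D_1 (Umat u A i x) z
    + bracket (Amat u A x z) (Umat u A i x z)
  = \sum_c (z - pole_at u c x)^-1 *: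
      (partial i (A c) x
       - schlesinger_rhs (fun a => pole_at u a x) velocity (A^~ x) c).
Proof.
move=> zp; have zp0 a : z - pole_at u a x != 0 by rewrite subr_eq0.
have dA : is_derive x (delta_mx ord0 i : 'rV[C]_K) (fun y => Amat u A y z)
   (\sum_a ((z - pole_at u a x)^-1 *: partial i (A a) x
            + (velocity a / (z - pole_at u a x) ^+ 2) *: A a x)).
  apply: is_derive_sum_fin => a.
  apply: is_derive_scale; last exact: derivableP.
  apply: is_derive_eq.
    apply: (is_derive_inv (fun y => z - pole_at u a y)) => //.
    exact: is_deriveB (is_derive_cst z x _) (is_derive_pole_at a).
  by rewrite sub0r opprK.
have dU : is_derive z 1 (Umat u A i x)
   (\sum_a (velocity a / (z - pole_at u a x) ^+ 2) *: A a x).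
  rewrite (_ : Umat u A i x = fun z =>
      \sum_a (z - pole_at u a x)^-1 *: (- velocity a *: A a x)); last first.
    apply/funext => w; rewrite UmatE -sumrN; apply: eq_bigr => a _.
    by rewrite scalerA mulrN scaleNr mulrC.
  apply: is_derive_sum_fin => a.
  apply: is_derive_eq.
    apply: is_derive_scale.
    apply: (is_derive_inv (fun w : C => w - pole_at u a x)) => //.
  by rewrite scaler0 add0r subr0 scalerA mulNr mulrNN mul1r mulrC.
rewrite /partial (@derive_val _ _ _ _ _ _ _ dA) (@derive_val _ _ _ _ _ _ _ dU).
rewrite big_split/= addrK UmatE.
rewrite (bracket_simple_fractions (fun a => pole_at u a x))// -sumrB.
by apply: eq_bigr => a _; rewrite [RHS]scalerBr.
Qed.

Lemma schlesinger_rhsE c :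
  schlesinger_rhs (fun a => pole_at u a x) velocity (A^~ x) c =
  (x ord0 i - pole_at u c x)^-1 *: bracket (A (poleX i) x) (A c x)
  + \sum_(k < N) (partial i (u k) x / (u k x - pole_at u c x))
      *: bracket (A (poleU k) x) (A c x)
  - velocity c *: \sum_(a | a != c) (pole_at u a x - pole_at u c x)^-1
      *: bracket (A a x) (A c x).
Proof.
rewrite /schlesinger_rhs.
rewrite (sum_velocity (fun a => (pole_at u a x - pole_at u c x)^-1)
                      (fun a => bracket (A a x) (A c x))) /=.
by congr (_ - _ *: _); rewrite (bigD1 c)//= bracketxx scaler0 add0r.
Qed.

(** A label is [poleX i], some [poleU m], or a pole of velocity zero, and these
    are the three cases of the system. *)
Lemma schlesinger_equations :
  (forall c, partial i (A c) x =
     schlesinger_rhs (fun a => pole_at u a x) velocity (A^~ x) c)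
  <-> [/\ schlesinger_fixed u A i x, schlesinger_u u A i x
        & schlesinger_x u A i x].
Proof.
have rhs_fixed c : c != poleX i -> (forall k, c != poleU k) ->
    schlesinger_rhs (fun a => pole_at u a x) velocity (A^~ x) c =
    (x ord0 i - pole_at u c x)^-1 *: bracket (A (poleX i) x) (A c x)
    + \sum_(k < N) (partial i (u k) x / (u k x - pole_at u c x))
        *: bracket (A (poleU k) x) (A c x).
  move=> cX cU; rewrite schlesinger_rhsE (_ : velocity c = 0).
    by rewrite scale0r subr0.
  case: c cX cU => [b|[j|j]]//= cX cU; last by have := cU j; rewrite eqxx.
  by case: eqVneq => // ij; rewrite ij eqxx in cX.
have rhs_u m :
    schlesinger_rhs (fun a => pole_at u a x) velocity (A^~ x) (poleU m) =
    (x ord0 i - u m x)^-1 *: bracket (A (poleX i) x) (A (poleU m) x)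
    + \sum_(k < N | k != m) (partial i (u k) x / (u k x - u m x))
        *: bracket (A (poleU k) x) (A (poleU m) x)
    - partial i (u m) x *:
        \sum_(a : pole K N | a != poleU m) (pole_at u a x - u m x)^-1
          *: bracket (A a x) (A (poleU m) x).
  rewrite schlesinger_rhsE /=; congr (_ + _ - _).
  by rewrite (bigD1 m)//= bracketxx scaler0 add0r.
have rhs_x :
    schlesinger_rhs (fun a => pole_at u a x) velocity (A^~ x) (poleX i) =
    - (\sum_(a : pole K N | a != poleX i) (x ord0 i - pole_at u a x)^-1
        *: bracket (A (poleX i) x) (A a x))
    + \sum_(k < N) (partial i (u k) x / (u k x - x ord0 i))
        *: bracket (A (poleU k) x) (A (poleX i) x).
  rewrite schlesinger_rhsE /= bracketxx scaler0 add0r eqxx scale1r addrC.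
  congr (- _ + _); apply: eq_bigr => a _.
  by rewrite bracketC scalerN -scaleNr -invrN opprB.
split=> [eqs|[eq_fixed eq_u eq_x] c].
  split=> [a aX aU|m|]; first by rewrite eqs rhs_fixed.
    by rewrite eqs rhs_u.
  by rewrite /schlesinger_x eqs rhs_x.
have [->|cX] := eqVneq c (poleX i); first by rewrite rhs_x.
case: (boolP [forall k, c != poleU k]) => [/forallP cU|].
  by rewrite eq_fixed// rhs_fixed.
by rewrite negb_forall => /existsP[m]; rewrite negbK => /eqP ->; rewrite eq_u rhs_u.
Qed.

Lemma compatible_at :
  (forall z, (forall a, z != pole_at u a x) ->
    partial i (fun y => Amat u A y z) x - 'D_1 (Umat u A i x) z
      + bracket (Amat u A x z) (Umat u A i x z) = 0)
  <-> [/\ schlesinger_fixed u A i x, schlesinger_u u A i x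
        & schlesinger_x u A i x].
Proof.
rewrite -schlesinger_equations; split=> [comp c|eqs z zp].
  apply/eqP; rewrite -subr_eq0; apply/eqP; move: c.
  apply: (residues_eq0 (fun a => pole_at u a x)) => // z zp.
  by rewrite -compatibility_expansion ?comp.
by rewrite compatibility_expansion// big1// => c _; rewrite eqs subrr scaler0.
Qed.

End Compatibility.

Theorem theorem1 (R : realType) (g K : nat)
    (g_gt0 : (0 < g)%N) (K_gt0 : (0 < K)%N) (K_lt : (K < 2 * g)%N)
    (D : set 'rV[Cfield R]_K) (openD : open D)
    (u : 'I_(2 * g - 1 - K) -> 'rV[Cfield R]_K -> Cfield R)
    (A : pole K (2 * g - 1 - K) -> 'rV[Cfield R]_K -> 'M[Cfield R]_2)
    (u_diff : forall j x, D x -> differentiable (u j) x)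
    (A_deriv : forall a i x, D x ->
       derivable (A a) x (delta_mx ord0 i : 'rV[Cfield R]_K))
    (distinct : forall x, D x -> injective (fun a => pole_at u a x)) :
  compatible u A D <-> constrained_schlesinger u A D.
Proof.
have pointwise i x (Dx : D x) := @compatible_at _ _ _ u A i x
  (fun j => diff_derivable (u_diff j x Dx)) (fun a => A_deriv a i x Dx)
  (distinct x Dx).
by split=> H i x Dx; [apply/pointwise|apply/(pointwise i x)] => //; exact: H.
Qed.
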